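(* Let $m = 37q$, where $q = -q_1\cdots q_n$ with $q_1,\dots,q_n$ distinct primes satisfying $\left(\frac{q_j}{37}\right)=1$ for all $j$, and $q\equiv 1 \pmod 8$. Then over the imaginary quadratic field $K=\mathbb{Q}(\sqrt{m})$ there exists an elliptic curve $E/K$ with everywhere good reduction; moreover such an $E$ can be chosen with $j(E)=16^3$.
   Context: $\left(\frac{a}{p}\right)$ denotes the Legendre symbol. An elliptic curve $E/K$ has everywhere good reduction if it has good reduction at every prime of $\mathcal{O}_K$. *)

(* Defs.v *)
(* Number fields are modelled as subfields of algC. *)
From HB Require Import structures.
From mathcomp Require Import all_boot all_order all_algebra all_field.
Set Implicit Arguments. Unset Strict Implicit. Unset Printing Implicit Defensive.
Import Order.TTheory GRing.Theory Num.Theory.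
Local Open Scope ring_scope.

Definition legendre (a : int) (p : nat) : int :=
  if (p%:Z %| a)%Z then 0
  else if [exists x : 'I_p, ((x%:Z) ^+ 2 - a == 0 %[mod p%:Z])%Z] then 1 else -1.

Definition quadK (m : int) : algC -> Prop :=
  fun x => exists a b : rat, x = ratr a + ratr b * sqrtC (m%:~R).

Definition ringOfIntegers (K : algC -> Prop) : algC -> Prop :=
  fun x => K x /\ x \in Aint.

Definition nonzero_prime_ideal (K : algC -> Prop) (P : algC -> Prop) : Prop :=
  (forall x, P x -> ringOfIntegers K x) /\
  P 0 /\
  (forall x y, P x -> P y -> P (x + y)) /\
  (forall r x, ringOfIntegers K r -> P x -> P (r * x)) /\
  ~ P 1 /\
  (forall x y, ringOfIntegers K x -> ringOfIntegers K y -> P (x * y) -> P x \/ P y) /\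
  (exists x, P x /\ x != 0).

Definition localRing (K : algC -> Prop) (P : algC -> Prop) : algC -> Prop :=
  fun x => K x /\ exists s, [/\ ringOfIntegers K s, ~ P s & ringOfIntegers K (s * x)].

Definition localUnit (K : algC -> Prop) (P : algC -> Prop) (x : algC) : Prop :=
  x != 0 /\ localRing K P x /\ localRing K P x^-1.

(* Long Weierstrass equations y^2 + a1 xy + a3 y = x^3 + a2 x^2 + a4 x + a6. *)
Record wmodel := WModel { wa1 : algC; wa2 : algC; wa3 : algC; wa4 : algC; wa6 : algC }.

Definition wb2 (E : wmodel) := wa1 E ^+ 2 + 4%:R * wa2 E.
Definition wb4 (E : wmodel) := 2%:R * wa4 E + wa1 E * wa3 E.
Definition wb6 (E : wmodel) := wa3 E ^+ 2 + 4%:R * wa6 E.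
Definition wb8 (E : wmodel) :=
  wa1 E ^+ 2 * wa6 E + 4%:R * wa2 E * wa6 E - wa1 E * wa3 E * wa4 E
  + wa2 E * wa3 E ^+ 2 - wa4 E ^+ 2.
Definition wc4 (E : wmodel) := wb2 E ^+ 2 - 24%:R * wb4 E.
Definition wdisc (E : wmodel) :=
  - wb2 E ^+ 2 * wb8 E - 8%:R * wb4 E ^+ 3 - 27%:R * wb6 E ^+ 2
  + 9%:R * wb2 E * wb4 E * wb6 E.
Definition jinv (E : wmodel) := wc4 E ^+ 3 / wdisc E.

Definition defined_over (K : algC -> Prop) (E : wmodel) : Prop :=
  [/\ K (wa1 E), K (wa2 E), K (wa3 E), K (wa4 E) & K (wa6 E)].

Definition elliptic_over (K : algC -> Prop) (E : wmodel) : Prop :=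
  defined_over K E /\ wdisc E != 0.

(* Change of variables x = u^2 x' + r, y = u^3 y' + u^2 s x' + t (Silverman, Table 3.1). *)
Definition wchange (E : wmodel) (u r s t : algC) : wmodel :=
  let a1 := wa1 E in let a2 := wa2 E in let a3 := wa3 E in
  let a4 := wa4 E in let a6 := wa6 E in
  WModel ((a1 + 2%:R * s) / u)
         ((a2 - s * a1 + 3%:R * r - s ^+ 2) / u ^+ 2)
         ((a3 + r * a1 + 2%:R * t) / u ^+ 3)
         ((a4 - s * a3 + 2%:R * r * a2 - (t + r * s) * a1 + 3%:R * r ^+ 2
           - 2%:R * s * t) / u ^+ 4)
         ((a6 + r * a4 + r ^+ 2 * a2 + r ^+ 3 - t * a3 - t ^+ 2 - r * t * a1)
           / u ^+ 6).

Definition good_reduction_at (K : algC -> Prop) (P : algC -> Prop) (E : wmodel) : Prop :=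
  exists u r s t, [/\ K u, u != 0, K r, K s & K t] /\ (
    let E' := wchange E u r s t in
    [/\ localRing K P (wa1 E'), localRing K P (wa2 E'), localRing K P (wa3 E'),
        localRing K P (wa4 E') & localRing K P (wa6 E')]
    /\ localUnit K P (wdisc E')).

Definition everywhere_good_reduction (K : algC -> Prop) (E : wmodel) : Prop :=
  forall P, nonzero_prime_ideal K P -> good_reduction_at K P E.

(* Main.v *)
Require Import Defs.
From Stdlib Require Import Classical_Prop.
From HB Require Import structures.
From mathcomp Require Import all_boot all_order all_algebra all_fingroup.
From mathcomp Require Import all_solvable all_field.
From mathcomp Require Import ring zify.
Import Order.TTheory GRing.Theory Num.Theory.
Local Open Scope ring_scope.

(* For v in K the curve y^2 = x^3 + v x^2 - 12 v^2 x - (67/4) v^3 has j = 16^3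
   and discriminant 37^3 v^6.  It has everywhere good reduction as soon as v is
   an integer with (v) = p a^2, where p is the prime above 37 and a is prime
   to 2, and v^3 = 1 mod 4: away from 37 one rescales by a local generator of a,
   at p by sqrt m (as 37^3 v^6 has valuation 12 there), and at 2 one completes
   y^2 to y^2 + y.

   Such a v is (37 x + y sqrt m) / 2 with 4 z^2 = 37 x^2 - q y^2, whose norm is
   37 z^2.  To solve this conic with z odd, each q_j splits in Q(sqrt 37) by
   quadratic reciprocity (via Gauss sums), all binary forms of discriminant 37
   are equivalent, and the fundamental unit has norm -1, so that q_j, hence
   |q|, is a value of a^2 + a b - 9 b^2; this gives y = 4 or y = 1 according to
   the parity of b. *)

(** * The square of a quadratic Gauss sum *)

Lemma prim_expr_FpD (F : nzRingType) (l : nat) (z : F) (x y : 'F_l) :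
  prime l -> l.-primitive_root z -> z ^+ (x + y)%R = z ^+ x * z ^+ y.
Proof.
move=> pl pz; rewrite -exprD -(prim_expr_mod pz (x + y)); congr (z ^+ _) => /=.
by congr modn; apply: Fp_cast.
Qed.

(** Translating y by 1 multiplies the sum by z^u, which differs from 1 unless u = 0. *)
Lemma sum_unity_root (F : idomainType) (l : nat) (z : F) (u : 'F_l) :
  prime l -> l.-primitive_root z ->
  \sum_(y : 'F_l) z ^+ (u * y)%R = if u == 0 then l%:R else 0.
Proof.
move=> pl pz.
have eD x y := prim_expr_FpD _ _ z x y pl pz.
case: eqP => [->|/eqP u0].
  rewrite (eq_bigr (fun=> 1)) => [|y _]; last by rewrite mul0r expr0.
  by rewrite sumr_const card_Fp.
set S := \sum_y _.
have eS : z ^+ u * S = S.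
  rewrite /S mulr_sumr [RHS](reindex_inj (addrI 1)).
  by apply: eq_bigr => y _; rewrite -eD mulrDr mulr1.
have eu1 : z ^+ u - 1 != 0.
  rewrite subr_eq0 -(prim_order_dvd pz); apply: contra u0 => lu.
  have ul : (u < l)%N by rewrite -[X in (_ < X)%N](Fp_cast pl) ltn_ord.
  by apply/eqP/val_inj/eqP; rewrite /= -[X in X == _](modn_small ul).
by apply/eqP; move/eqP: eS; rewrite -subr_eq0 -{2}[S]mul1r -mulrBl mulf_eq0
  (negPf eu1).
Qed.

(* Since -1 = t^2, replacing y by t y turns the square of the sum into the sum of
   z^(x^2 - y^2), where x = y + u makes the inner sum geometric. *)
Lemma quadratic_gauss_sum_sqr (F : idomainType) (l : nat) (z : F) (t : 'F_l) :
  prime l -> odd l -> l.-primitive_root z -> t ^+ 2 = -1 ->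
  (\sum_(x : 'F_l) z ^+ (x ^+ 2)%R) ^+ 2 = l%:R.
Proof.
move=> pl ol pz tE.
have eD x y := prim_expr_FpD _ _ z x y pl pz.
have t0 : t != 0.
  by apply/eqP => t0; move/eqP: tE; rewrite t0 expr0n eq_sym oppr_eq0 oner_eq0.
have two0 : (2%:R : 'F_l) != 0.
  rewrite -(dvdn_pcharf (pchar_Fp pl)); apply: contraL ol => l2.
  by rewrite (eqP (_ : l == 2)) // -dvdn_prime2.
transitivity (\sum_(y : 'F_l) \sum_(x : 'F_l) z ^+ (x ^+ 2 - y ^+ 2)%R).
  rewrite expr2 {2}(reindex_inj (mulfI t0)) mulr_sumr.
  apply: eq_bigr => y _; rewrite mulr_suml; apply: eq_bigr => x _.
  by rewrite -eD exprMn tE mulN1r.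
under eq_bigr => y _ do rewrite (reindex_inj (addrI y)).
rewrite exchange_big (bigD1 0) // -[RHS]addr0; congr (_ + _).
  rewrite (eq_bigr (fun=> 1)) => [|y _].
    by rewrite sumr_const card_Fp.
  by rewrite addr0 subrr expr0.
rewrite big1 // => u u0.
rewrite (eq_bigr (fun y : 'F_l => z ^+ (u ^+ 2)%R * z ^+ (2%:R * u * y)%R)).
  by rewrite -mulr_sumr sum_unity_root // mulf_eq0 (negPf two0) (negPf u0) mulr0.
by move=> y _; rewrite -eD; congr (z ^+ (nat_of_ord _)); ring.
Qed.

(** In characteristic p the Frobenius sends z^(x^2) to z^(p x^2) = z^((c x)^2), so it only permutes
    the terms. *)
Lemma quadratic_gauss_sum_Frobenius (F : idomainType) (p l : nat) (z : F)
    (c : 'F_l) :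
  prime l -> l.-primitive_root z -> p \in [pchar F] -> c != 0 ->
  p%:R = c ^+ 2 ->
  (\sum_(x : 'F_l) z ^+ (x ^+ 2)%R) ^+ p = \sum_(x : 'F_l) z ^+ (x ^+ 2)%R.
Proof.
move=> pl pz pF c0 cE.
rewrite -(pFrobenius_autE pF) rmorph_sum [RHS](reindex_inj (mulfI c0)).
apply: eq_bigr => x _; rewrite [LHS]pFrobenius_autE -exprM.
have -> : (c * x) ^+ 2 = x ^+ 2 *+ p by rewrite exprMn -cE mulr_natl.
rewrite -(prim_expr_mod pz) -[RHS](prim_expr_mod pz) Zp_mulrn; congr (z ^+ _).
rewrite -[LHS]modn_mod; congr (_ %% _)%N => /=; congr modn.
exact: esym (Fp_cast pl).
Qed.

(** By Fermat, l divides p^(l-1) - 1, the order of the unit group of the field with p^(l-1)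
    elements; Cauchy's theorem then gives a unit of order l. *)
Lemma exists_prim_root_pchar (p l : nat) : prime p -> prime l -> p != l ->
  exists F : finFieldType, p \in [pchar F] /\ exists z : F, l.-primitive_root z.
Proof.
move=> pp pl npl; have l1_gt0 : (0 < l.-1)%N.
  by rewrite -ltnS prednK ?prime_gt0 ?prime_gt1.
have [F pF cF] := pPrimePowerField pp l1_gt0; exists F; split=> //.
have : (l %| #|[set: {unit F}]%G|)%N.
  rewrite card_finField_unit cF -subn1 -eqn_mod_dvd ?expn_gt0 ?prime_gt0 //.
  apply/eqP; rewrite -totient_prime //; apply: Euler_exp_totient.
  by rewrite prime_coprime // dvdn_prime2.
case/(Cauchy pl) => u _ ou; exists (FinRing.uval u).
apply/andP; split; first by rewrite prime_gt0.
apply/forallP => i.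
rewrite unity_rootE -FinRing.val_unitX -FinRing.val_unit1 val_eqE.
rewrite -order_dvdn ou.
have [E|il] := eqVneq i.+1 l; first by rewrite E dvdnn.
by rewrite eqbF_neg gtnNdvd // ltn_neqAle il ltn_ord.
Qed.

(** The images of 0, ..., p - 1 are already p distinct roots of X^p - X, which leaves no room for
    another. *)
Lemma pchar_fixed_nat (F : fieldType) (p : nat) (x : F) : p \in [pchar F] ->
  x ^+ p = x -> exists k : nat, x = k%:R.
Proof.
move=> pF xE; have pp := pcharf_prime pF.
pose rs : seq F := [seq k%:R | k <- iota 0 p].
suff /mapP[k _ ->] : x \in rs by exists k.
apply/negPn/negP => nx.
have nz : ('X^p - 'X : {poly F}) != 0.
  apply/eqP => /(congr1 (coefp p)).
  rewrite /= coefB coefXn eqxx coefX coef0 gtn_eqF ?prime_gt1 // subr0.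
  by apply/eqP; rewrite oner_eq0.
have sz : size ('X^p - 'X : {poly F}) = p.+1.
  by rewrite size_polyDl size_polyXn // size_polyN size_polyX ltnS prime_gt1.
have : (size (x :: rs) < p.+1)%N.
  rewrite -sz; apply: max_poly_roots => //.
    rewrite /= rootE !hornerE xE subrr eqxx /=.
    apply/allP => y /mapP[k _ ->].
    by rewrite rootE !hornerE -(pFrobenius_autE pF) pFrobenius_aut_nat subrr.
  rewrite /= nx /= map_inj_in_uniq ?iota_uniq // => i j.
  rewrite !mem_iota !add0n /=.
  wlog le_ij : i j / (i <= j)%N => [th|] ip jp E.
    by case: (leqP i j) => [|/ltnW] h; [|symmetry]; apply: th.
  apply/eqP; rewrite eqn_leq le_ij /= -subn_eq0.
  have : (p %| j - i)%N by rewrite (dvdn_pcharf pF) natrB // E subrr.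
  by case: (posnP (j - i)) => // ji; rewrite gtnNdvd // ltn_subLR // ltn_addl.
by rewrite /= size_map size_iota ltnn.
Qed.

(** In characteristic p the Gauss sum is fixed by Frobenius, hence is the image of a natural number
    k, while its square is l. *)
Lemma sqrt_mod_of_reciprocity (p l : nat) (t c : 'F_l) :
  prime p -> prime l -> odd l -> t ^+ 2 = -1 -> c != 0 -> p%:R = c ^+ 2 ->
  exists k : nat, (p%:Z %| k%:Z ^+ 2 - l%:Z)%Z.
Proof.
move=> pp pl ol tE c0 cE.
have npl : p != l.
  apply: contraNneq c0 => pE; have := cE; rewrite pE pchar_Fp_0 //.
  by move=> /esym/eqP; rewrite expf_eq0.
have [F [pF [z pz]]] := exists_prim_root_pchar _ _ pp pl npl.
have [k kE] := pchar_fixed_nat _ _ _ pF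
  (quadratic_gauss_sum_Frobenius _ _ _ _ _ pl pz pF c0 cE).
exists k; rewrite (dvdz_pcharf pF) rmorphB rmorphXn /= -!pmulrn -kE.
by rewrite (quadratic_gauss_sum_sqr _ _ _ _ pl ol pz tE) subrr.
Qed.

(** * The norm form of discriminant 37 *)

(** The norm of a + b w, where w = (1 + sqrt 37) / 2 satisfies w^2 = w + 9. *)
Definition norm37 (a b : int) : int := a ^+ 2 + a * b - 9 * b ^+ 2.

Lemma norm37M (a b c d : int) :
  norm37 a b * norm37 c d = norm37 (a * c + 9 * b * d) (a * d + b * c + b * d).
Proof. rewrite /norm37; ring. Qed.

(* The form A X^2 + B X Y + C Y^2 is the norm of (a + b w) X + (c + d w) Y, with
   w = (1 + sqrt 37) / 2. *)
Definition norm37_form (A B C : int) : Prop := exists a b c d : int,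
  [/\ A = norm37 a b, C = norm37 c d
    & B = 2 * a * c + a * d + b * c - 18 * b * d].

Lemma norm37_form_sym (A B C : int) : norm37_form A B C -> norm37_form C B A.
Proof.
move=> [a [b [c [d [-> [-> ->]]]]]]; exists c, d, a, b; split=> //; ring.
Qed.

(** The hypothesis concerns the form after X is replaced by X + k Y; undoing this subtracts k (a + b
    w) from c + d w. *)
Lemma norm37_form_shift (A B C k : int) :
  norm37_form A (B + 2 * A * k) (A * k ^+ 2 + B * k + C) -> norm37_form A B C.
Proof.
move=> [a [b [c [d []]]]]; rewrite /norm37 => EA EC EB.
exists a, b, (c - k * a), (d - k * b); rewrite /norm37; split=> //.
  by transitivity ((A * k ^+ 2 + B * k + C) - k * (B + 2 * A * k) + k ^+ 2 * A);
    [ring | rewrite EC EB EA; ring].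
by transitivity ((B + 2 * A * k) - 2 * k * A); [ring | rewrite EB EA; ring].
Qed.

Lemma norm37_form_small (A B C : int) : B ^+ 2 - 4 * A * C = 37 ->
  A != 0 -> -3 <= A <= 3 -> - `|A| <= B <= `|A| -> norm37_form A B C.
Proof.
move=> D A0 A3 BA.
(* Running through the bounded pairs (A, B) leaves eight reduced forms. *)
have : (A = 3 /\ B = 1 /\ C = -3) \/ (A = 3 /\ B = -1 /\ C = -3) \/
       (A = -3 /\ B = 1 /\ C = 3) \/ (A = -3 /\ B = -1 /\ C = 3) \/
       (A = 1 /\ B = 1 /\ C = -9) \/ (A = 1 /\ B = -1 /\ C = -9) \/
       (A = -1 /\ B = 1 /\ C = 9) \/ (A = -1 /\ B = -1 /\ C = 9).
  have : A = -3 \/ A = -2 \/ A = -1 \/ A = 1 \/ A = 2 \/ A = 3 by lia.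
  have : B = -3 \/ B = -2 \/ B = -1 \/ B = 0 \/ B = 1 \/ B = 2 \/ B = 3 by lia.
  move=> EB EA.
  by case: EB D BA => [->|[->|[->|[->|[->|[->|->]]]]]] D BA;
     case: EA D BA => [->|[->|[->|[->|[->|->]]]]] D BA; lia.
case=> [[-> [-> ->]]|[[-> [-> ->]]|[[-> [-> ->]]|[[-> [-> ->]]|
  [[-> [-> ->]]|[[-> [-> ->]]|[[-> [-> ->]]|[-> [-> ->]]]]]]]]].
- by exists (-3), (-1), (2), (1).
- by exists (-3), (-1), (-2), (-1).
- by exists (-2), (-1), (3), (1).
- by exists (-2), (-1), (-3), (-1).
- by exists (-1), (0), (-1), (1).
- by exists (-1), (0), (0), (1).
(* Here A = -1 is the norm of -(5 + 2 w), and 5 + 2 w = 6 + sqrt 37 is the fundamental unit. *)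
- by exists (-5), (-2), (-13), (-5).
- by exists (-5), (-2), (13), (5).
Qed.

(** Gauss reduction, by induction on |A|: a shift brings B into [-|A|, |A|], and while |A| >= 4
    exchanging the outer coefficients makes |A| smaller. *)
Lemma disc37_norm37_form (A B C : int) :
  B ^+ 2 - 4 * A * C = 37 -> norm37_form A B C.
Proof.
have [n] := ubnP `|A|%N; elim: n A B C => // n IH A B C leA D.
(* Otherwise B^2 = 37, which lies strictly between 6^2 and 7^2. *)
have A0 : A != 0.
  apply/eqP => A0; move: D; rewrite A0 mulr0 mul0r subr0 expr2 => D.
  have : `|B| <= 6 \/ 7 <= `|B| by lia.
  by case=> ?; nia.
have [k /andP[Bk1 Bk2]] : exists k, - `|A| <= B + 2 * A * k <= `|A|.
  exists (- ((B + `|A|) %/ (2 * A))%Z).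
  have A2 : 2 * A != 0 by lia.
  have := divz_eq (B + `|A|) (2 * A); have := modz_ge0 (B + `|A|) A2.
  have := ltz_mod (B + `|A|) A2.
  move: (_ %/ _)%Z (_ %% _)%Z => k r; lia.
apply: (norm37_form_shift _ _ _ k).
have D' : (B + 2 * A * k) ^+ 2 - 4 * A * (A * k ^+ 2 + B * k + C) = 37.
  by rewrite -D; ring.
move: (A * k ^+ 2 + _ + _) (B + 2 * A * k) D' Bk1 Bk2 => C' B' D' Bk1 Bk2.
have [A3|A4] : `|A| <= 3 \/ 4 <= `|A| by lia.
  by apply: norm37_form_small => //; lia.
apply/norm37_form_sym/IH; last by rewrite -D'; ring.
(* If |A| <= |C'| then 4 A^2 <= |B'^2 - 37| with B'^2 <= A^2, impossible once A^2 >= 16. *)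
suff : `|C'| < `|A| by lia.
have BA : B' ^+ 2 <= A ^+ 2.
  rewrite -(real_normK (num_real A)) -subr_ge0 subr_sqr mulr_ge0 //; lia.
have A16 : 4 ^+ 2 <= A ^+ 2.
  rewrite -(real_normK (num_real A)) -subr_ge0 subr_sqr mulr_ge0 //; lia.
rewrite ltNge; apply/negP => CA.
have : A ^+ 2 <= `|A * C'|.
  by rewrite normrM -(real_normK (num_real A)) expr2 ler_wpM2l.
have := sqr_ge0 B'; move: D' BA A16; rewrite -mulrA.
move: (A * C') (A ^+ 2) (B' ^+ 2) => ac a2 b2; clear; lia.
Qed.


(** An odd square root 2 r + 1 of 37 mod p gives (2 r + 1)^2 - 37 = 4 p C, so p is the leading
    coefficient of a form of discriminant 37. *)
Lemma prime_norm37 (p : nat) (k : int) : odd p -> (p%:Z %| k ^+ 2 - 37)%Z ->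
  exists a b, p%:Z = norm37 a b.
Proof.
move=> op pk.
have [r /dvdzP[c E]] : exists r, (p%:Z %| (2 * r + 1) ^+ 2 - 37)%Z.
  (* As p is odd, one of k and k + p is odd. *)
  have [r kE] : exists r, k = 2 * r + 1 \/ k + p%:Z = 2 * r + 1.
    have pE : p%:Z = 2 * p./2%:Z + 1 by lia.
    have := divz_eq k 2; have := @modz_ge0 k 2 isT; have := @ltz_mod k 2 isT.
    move: (k %/ 2)%Z (k %% 2)%Z => s e e2 e0 kE.
    have [e1|e1] : e = 1 \/ e = 0 by lia.
      by exists s; lia.
    by exists (s + p./2%:Z); lia.
  exists r; case: kE => <- //.
  have -> : (k + p%:Z) ^+ 2 - 37 = (k ^+ 2 - 37) + (2 * k + p%:Z) * p%:Z.
    by ring.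
  by rewrite rpredD ?dvdz_mull.
have : (4 %| c)%Z.
  have c4 : coprimez 4 p%:Z by rewrite coprimezE (@coprimeXl 2 2) // coprime2n.
  rewrite -(Gauss_dvdzl _ c4) -E; apply/dvdzP; exists (r ^+ 2 + r - 9); ring.
case/dvdzP => C cE.
have [|a [b [_ [_ [-> _ _]]]]] := disc37_norm37_form p%:Z (2 * r + 1) C.
  move: E; rewrite cE => /eqP; rewrite subr_eq => /eqP ->; ring.
by exists a, b.
Qed.

Lemma prod_norm37 (qs : seq nat) :
  (forall p, p \in qs -> exists a b, p%:Z = norm37 a b) ->
  exists a b, (\prod_(p <- qs) p)%:Z = norm37 a b.
Proof.
elim: qs => [_|p qs IH H]; first by exists 1, 0; rewrite big_nil.
have [|a [b E]] := IH; first by move=> r rq; apply: H; rewrite inE rq orbT.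
have [c [d F]] := H p (mem_head _ _).
by rewrite big_cons PoszM E F norm37M; do 2 eexists.
Qed.

(** * Integers of quadratic fields and their localizations *)

Lemma sqrtC_intK (m : int) : sqrtC (m%:~R : algC) ^+ 2 = ratr (m%:~R : rat).
Proof. by rewrite sqrtCK ratr_int. Qed.

Lemma quadK_ratr (m : int) (a : rat) : quadK m (ratr a).
Proof. by exists a, 0; rewrite rmorph0 mul0r addr0. Qed.

Lemma quadK_int (m n : int) : quadK m n%:~R.
Proof. by rewrite -[n%:~R]ratr_int; apply: quadK_ratr. Qed.

Lemma quadK_sqrt (m : int) : quadK m (sqrtC m%:~R).
Proof. by exists 0, 1; rewrite rmorph0 rmorph1 mul1r add0r. Qed.

Lemma quadKD (m : int) (x y : algC) : quadK m x -> quadK m y -> quadK m (x + y).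
Proof.
move=> [a [b ->]] [c [d ->]]; exists (a + c), (b + d).
by rewrite !rmorphD; ring.
Qed.

Lemma quadKM (m : int) (x y : algC) : quadK m x -> quadK m y -> quadK m (x * y).
Proof.
move=> [a [b ->]] [c [d ->]].
exists (a * c + b * d * m%:~R), (a * d + b * c).
by rewrite !rmorphD !rmorphM /= -sqrtC_intK; ring.
Qed.

Lemma quadKN (m : int) (x : algC) : quadK m x -> quadK m (- x).
Proof. by move=> Kx; rewrite -mulN1r; apply: quadKM (quadK_int m (-1)) Kx. Qed.

Lemma quadKX (m : int) (x : algC) (n : nat) : quadK m x -> quadK m (x ^+ n).
Proof.
move=> Kx; elim: n => [|n IH]; first exact: quadK_int m 1.
by rewrite exprS; apply: quadKM.
Qed.

Lemma quadKV (m : int) (x : algC) : quadK m x -> quadK m x^-1.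
Proof.
move=> [a [b ->]]; set s := sqrtC _; pose c := ratr a - ratr b * s.
(* The conjugate [c] can vanish, for instance when m is a square; the element is then the rational
   number 2 a. *)
have [c0|c0] := eqVneq c 0.
  have -> : ratr a + ratr b * s = ratr (a + a).
    by move/eqP: c0; rewrite subr_eq0 rmorphD => /eqP <-.
  by rewrite -fmorphV; apply: quadK_ratr.
have Kc : quadK m c by exists a, (- b); rewrite rmorphN mulNr.
have nE : (ratr a + ratr b * s) * c = ratr (a ^+ 2 - b ^+ 2 * m%:~R).
  by rewrite !expr2 rmorphB !rmorphM /= -sqrtC_intK -/s /c; ring.
have -> : (ratr a + ratr b * s)^-1 = c * ((ratr a + ratr b * s) * c)^-1.
  by rewrite invfM mulrCA divff // mulr1.
by rewrite nE -fmorphV; apply: quadKM Kc (quadK_ratr _ _).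
Qed.

Lemma ringOfIntegers_quadK (m : int) (x : algC) :
  ringOfIntegers (quadK m) x -> quadK m x.
Proof. by case. Qed.

Lemma integer_int (m n : int) : ringOfIntegers (quadK m) n%:~R.
Proof. by split; [apply: quadK_int | apply: Aint_int]. Qed.

Lemma integer_nat (m : int) (n : nat) : ringOfIntegers (quadK m) n%:R.
Proof. exact: integer_int m n. Qed.

Lemma integerD (m : int) (x y : algC) : ringOfIntegers (quadK m) x ->
  ringOfIntegers (quadK m) y -> ringOfIntegers (quadK m) (x + y).
Proof. by move=> [? ?] [? ?]; split; [apply: quadKD | apply: rpredD]. Qed.

Lemma integerM (m : int) (x y : algC) : ringOfIntegers (quadK m) x ->
  ringOfIntegers (quadK m) y -> ringOfIntegers (quadK m) (x * y).
Proof. by move=> [? ?] [? ?]; split; [apply: quadKM | apply: rpredM]. Qed.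

Lemma integerN (m : int) (x : algC) : ringOfIntegers (quadK m) x ->
  ringOfIntegers (quadK m) (- x).
Proof. by move=> [? ?]; split; [apply: quadKN | rewrite rpredN]. Qed.

Lemma integerX (m : int) (x : algC) (n : nat) : ringOfIntegers (quadK m) x ->
  ringOfIntegers (quadK m) (x ^+ n).
Proof. by move=> [? ?]; split; [apply: quadKX | apply: rpredX]. Qed.

Lemma integer_quadratic (m t n : int) (x : algC) : quadK m x ->
  x ^+ 2 - t%:~R * x + n%:~R = 0 -> ringOfIntegers (quadK m) x.
Proof.
move=> Kx E; split=> //.
pose r : {poly algC} := - t%:~R *: 'X + n%:~R%:P.
have sr : (size r < 3)%N.
  rewrite (leq_ltn_trans (size_polyD _ _)) // gtn_max ltnS.
  rewrite (leq_trans (size_scale_leq _ _)) ?size_polyX //.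
  by rewrite (leq_ltn_trans (size_polyC_leq1 _)).
pose p := 'X^2 + r; apply: (@root_monic_Aint p).
- by rewrite /p /r rootE !hornerE mulNr; apply/eqP.
- by rewrite /p monicE lead_coefDl ?size_polyXn // lead_coefXn.
- apply/polyOverP => i; rewrite /p /r coefD coefXn coefD coefZ coefX coefC.
  rewrite !rpredD ?rpredM ?rpredN ?intr_int ?rpred_nat //.
  by case: ifP => _; [exact: intr_int | exact: rpred0].
Qed.

Lemma integer_sqrt (m : int) : ringOfIntegers (quadK m) (sqrtC m%:~R).
Proof.
apply: (@integer_quadratic m 0 (- m)); first exact: quadK_sqrt.
by rewrite sqrtCK rmorphN /=; ring.
Qed.

(** * Localization at a prime ideal *)

Lemma integer_localRing (m : int) (P : algC -> Prop) (x : algC) :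
  nonzero_prime_ideal (quadK m) P -> ringOfIntegers (quadK m) x ->
  localRing (quadK m) P x.
Proof.
move=> [_ [_ [_ [_ [P1 _]]]]] Ox; split; first by case: Ox.
by exists 1; split=> //; [apply: integer_int m 1 | rewrite mul1r].
Qed.

Lemma localRingN (m : int) (P : algC -> Prop) (x : algC) :
  localRing (quadK m) P x -> localRing (quadK m) P (- x).
Proof.
move=> [Kx [s [Os Ps Osx]]]; split; first exact: quadKN.
by exists s; split=> //; rewrite mulrN; apply: integerN.
Qed.

Lemma localRingM (m : int) (P : algC -> Prop) (x y : algC) :
  nonzero_prime_ideal (quadK m) P -> localRing (quadK m) P x ->
  localRing (quadK m) P y -> localRing (quadK m) P (x * y).
Proof.
move=> [_ [_ [_ [_ [_ [Pp _]]]]]] [Kx [s [Os Ps Osx]]] [Ky [t [Ot Pt Oty]]].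
split; first exact: quadKM.
exists (s * t); split; [exact: integerM | by move/(Pp _ _ Os Ot)=> [] |].
by rewrite mulrACA; apply: integerM.
Qed.

Lemma localUnit_localRing (m : int) (P : algC -> Prop) (x : algC) :
  localUnit (quadK m) P x -> localRing (quadK m) P x.
Proof. by case=> _ []. Qed.

Lemma localUnit_integer (m : int) (P : algC -> Prop) (x : algC) :
  nonzero_prime_ideal (quadK m) P -> ringOfIntegers (quadK m) x -> ~ P x ->
  localUnit (quadK m) P x.
Proof.
move=> HP Ox Px.
have x0 : x != 0 by apply/eqP => x0; apply: Px; rewrite x0; case: HP => _ [].
split=> //; split; first exact: integer_localRing.
split; first by case: Ox => Kx _; apply: quadKV.
by exists x; split=> //; rewrite divff //; apply: (integer_int m 1).
Qed.

Lemma localUnitV (m : int) (P : algC -> Prop) (x : algC) :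
  localUnit (quadK m) P x -> localUnit (quadK m) P x^-1.
Proof. by case=> x0 [Lx Lx']; rewrite /localUnit invr_eq0 invrK. Qed.

Lemma localUnitM (m : int) (P : algC -> Prop) (x y : algC) :
  nonzero_prime_ideal (quadK m) P -> localUnit (quadK m) P x ->
  localUnit (quadK m) P y -> localUnit (quadK m) P (x * y).
Proof.
move=> HP [x0 [Lx Lx']] [y0 [Ly Ly']]; split; first by rewrite mulf_neq0.
by rewrite invfM; split; apply: localRingM.
Qed.

Lemma localUnitX (m : int) (P : algC -> Prop) (x : algC) (n : nat) :
  nonzero_prime_ideal (quadK m) P -> localUnit (quadK m) P x ->
  localUnit (quadK m) P (x ^+ n).
Proof.
move=> HP Ux; elim: n => [|n IH]; last by rewrite exprS; apply: localUnitM.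
apply: localUnit_integer => //; first exact: (integer_int m 1).
by case: HP => _ [_ [_ [_ []]]].
Qed.

Lemma prime_ideal_coprime (m : int) (P : algC -> Prop) (a b : int) :
  nonzero_prime_ideal (quadK m) P -> coprimez a b ->
  P a%:~R -> P b%:~R -> False.
Proof.
move=> [_ [_ [PD [PM [P1 _]]]]] /coprimezP[[u v] /= E] Pa Pb; apply: P1.
rewrite -[1]/(1%:~R) -E rmorphD !rmorphM /=.
by apply: PD; apply: PM => //; apply: integer_int.
Qed.

Lemma prime_ideal_exp (m : int) (P : algC -> Prop) (x : algC) (n : nat) :
  nonzero_prime_ideal (quadK m) P -> ringOfIntegers (quadK m) x ->
  P (x ^+ n) -> P x.
Proof.
move=> [_ [_ [_ [_ [P1 [Pp _]]]]]] Ox; elim: n => [//|n IH].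
by rewrite exprS => /(Pp _ _ Ox (integerX _ _ _ Ox))[].
Qed.

Lemma prime_ideal_prod (m : int) (P : algC -> Prop) (s : seq nat) :
  nonzero_prime_ideal (quadK m) P -> P (\prod_(p <- s) p)%:R ->
  exists2 p, p \in s & P p%:R.
Proof.
move=> HP; have [_ [_ [_ [_ [P1 [Pp _]]]]]] := HP.
elim: s => [|p s IH]; first by rewrite big_nil.
rewrite big_cons natrM.
case/(Pp _ _ (integer_nat _ _) (integer_nat _ _)) => [Px|/IH[r rs Pr]].
  by exists p; rewrite ?mem_head.
by exists r; rewrite // inE rs orbT.
Qed.

Lemma wdisc_wchange (E : wmodel) (u r s t : algC) : u != 0 ->
  wdisc (wchange E u r s t) = wdisc E / u ^+ 12.
Proof.
case: E => a1 a2 a3 a4 a6 u0.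
rewrite /wdisc /wchange /wb2 /wb4 /wb6 /wb8 /=; field; exact: u0.
Qed.

(** * The twists with j-invariant 16^3 *)

(* Only meant for a3^2 + 4 a6 = - 67 v^3; then a3 = 0 and a3 = 1 give isomorphic
   curves, the latter integral when v^3 = 1 mod 4. *)
Definition curve37 (v a3 a6 : algC) : wmodel :=
  WModel 0 v a3 (- 12%:R * v ^+ 2) a6.

Lemma wdisc_curve37 (v a3 a6 : algC) : a3 ^+ 2 + 4%:R * a6 = - 67%:R * v ^+ 3 ->
  wdisc (curve37 v a3 a6) = 37%:R ^+ 3 * v ^+ 6.
Proof.
move=> E; have {E} -> : a6 = (- 67%:R * v ^+ 3 - a3 ^+ 2) / 4%:R.
  by rewrite -E; field.
by rewrite /wdisc /wb2 /wb4 /wb6 /wb8 /=; field.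
Qed.

Lemma wc4_curve37 (v a3 a6 : algC) :
  wc4 (curve37 v a3 a6) = 16%:R * 37%:R * v ^+ 2.
Proof. by rewrite /wc4 /wb2 /wb4 /=; ring. Qed.

Lemma jinv_curve37 (v a3 a6 : algC) : a3 ^+ 2 + 4%:R * a6 = - 67%:R * v ^+ 3 ->
  v != 0 -> jinv (curve37 v a3 a6) = (16 ^+ 3)%:R.
Proof.
move=> E v0; rewrite /jinv wdisc_curve37 // wc4_curve37.
have -> : (16 ^+ 3)%:R = 16%:R ^+ 3 :> algC by rewrite -[RHS]natrX.
by field.
Qed.

(** * Good reduction of the twists, prime by prime *)

Lemma quadK0 m : quadK m 0. Proof. exact: quadK_int m 0. Qed.

Lemma localRing_nat (m : int) (P : algC -> Prop) (n : nat) :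
  nonzero_prime_ideal (quadK m) P -> localRing (quadK m) P n%:R.
Proof. by move=> HP; apply: integer_localRing HP (integer_nat m n). Qed.

(** No change of variables is needed, even above 2: solving 1 + 4 a6 = -67 (1 + 4 tau) gives the
    integral value of a6 used here, and the discriminant 37^3 v^6 is a unit at P. *)
Lemma good_reduction_curve37_unit (m : int) (P : algC -> Prop) (v tau : algC) :
  nonzero_prime_ideal (quadK m) P ->
  ringOfIntegers (quadK m) v -> ringOfIntegers (quadK m) tau ->
  v ^+ 3 = 1 + 4%:R * tau -> ~ P 37%:R -> ~ P v ->
  good_reduction_at (quadK m) P (curve37 v 1 (- (17%:R + 67%:R * tau))).
Proof.
move=> HP Ov Ot E P37 Pv.
exists 1, 0, 0, 0; split.
  by split; rewrite ?oner_neq0 //; first [apply: quadK0 | apply: (quadK_int m 1)].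
cbv zeta; rewrite wdisc_wchange ?oner_neq0 // wdisc_curve37; last first.
  by rewrite E; ring.
have -> : wchange (curve37 v 1 (- (17%:R + 67%:R * tau))) 1 0 0 0
        = curve37 v 1 (- (17%:R + 67%:R * tau)).
  by rewrite /wchange /curve37 /=; congr WModel; field.
have Ln := localRing_nat _ _ _ HP.
split; last first.
  rewrite expr1n invr1 mulr1; apply: localUnitM => //; apply: localUnitX => //;
    by apply: localUnit_integer => //; apply: integer_nat.
split; rewrite /=.
- exact: Ln 0.
- exact: integer_localRing.
- exact: Ln 1.
- apply: (localRingM _ _ _ _ HP (localRingN _ _ _ (Ln _))).
  exact: integer_localRing HP (integerX _ _ _ Ov).
- apply: localRingN; apply: integer_localRing => //.
  by apply: integerD; [|apply: integerM Ot]; apply: integer_nat.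
Qed.

(* Rescaling by z replaces v by v / z^2 = 37 / w, a unit at P. *)
Lemma good_reduction_curve37_conj (m z : int) (P : algC -> Prop)
    (v w a3 a6 : algC) :
  nonzero_prime_ideal (quadK m) P ->
  ringOfIntegers (quadK m) w -> a3 \in Num.int ->
  v * w = 37%:R * z%:~R ^+ 2 -> a3 ^+ 2 + 4%:R * a6 = - 67%:R * v ^+ 3 ->
  z != 0 -> ~ P 37%:R -> ~ P 2%:R -> ~ P w ->
  good_reduction_at (quadK m) P (curve37 v a3 a6).
Proof.
move=> HP Ow /intrP[n ->] {a3} Evw E z0 P37 P2 Pw.
have zC : (z%:~R : algC) != 0 by rewrite intr_eq0.
have Ln := localRing_nat _ _ _ HP.
have Uw := localUnit_integer _ _ _ HP Ow Pw.
have U2 := localUnit_integer _ _ _ HP (integer_nat _ _) P2.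
have U37 := localUnit_integer _ _ _ HP (integer_nat _ _) P37.
have [w0 _] := Uw.
have vE : v = 37%:R * z%:~R ^+ 2 / w by rewrite -Evw mulfK.
have a6E : a6 = (- 67%:R * v ^+ 3 - n%:~R ^+ 2) / 4%:R by rewrite -E; field.
have two0 : 2%:R != 0 :> algC by rewrite pnatr_eq0.
(* The translation of y by -n/2 removes a3; 2 is a unit at P. *)
exists z%:~R, 0, 0, (- (n%:~R / 2%:R)); split.
  split=> //; try (exact: quadK0); try (exact: quadK_int).
  by apply/quadKN/quadKM; [apply: quadK_int | apply: (quadKV m _ (quadK_int m 2))].
cbv zeta; rewrite wdisc_wchange // wdisc_curve37 //.
have -> : wchange (curve37 v n%:~R a6) z%:~R 0 0 (- (n%:~R / 2%:R))
   = WModel 0 (37%:R * w^-1) 0 (- (12%:R * (37%:R * w^-1) ^+ 2))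
       (- (67%:R * (37%:R * w^-1) ^+ 3 * (2%:R^-1) ^+ 2)).
  rewrite a6E vE /wchange /curve37 /=; congr WModel; field; rewrite ?zC ?w0 //.
have -> : 37%:R ^+ 3 * v ^+ 6 / z%:~R ^+ 12 = 37%:R ^+ 9 * w^-1 ^+ 6.
  by rewrite vE; field; rewrite zC w0.
have L37 := localUnit_localRing _ _ _ U37.
have Lw := localUnit_localRing _ _ _ (localUnitV _ _ _ Uw).
have L2 := localUnit_localRing _ _ _ (localUnitV _ _ _ U2).
split; last first.
  by apply: localUnitM => //; apply: localUnitX => //; apply: localUnitV.
rewrite /= !expr2 !exprS expr0 !mulr1.
split; try exact: (Ln 0);
  by do !(apply: localRingN || apply: localRingM || apply: Ln || assumption).
Qed.

(* With s = sqrt m one has v = s k / (2 q) for a unit k at P; scaling by s in the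
   short Weierstrass model clears the twelve factors s of the discriminant. *)
Lemma good_reduction_curve37_above_37 (m q x y : int) (P : algC -> Prop)
    (v a3 a6 : algC) :
  nonzero_prime_ideal (quadK m) P ->
  a3 \in Num.int -> m = 37 * q -> q != 0 ->
  2%:R * v = (37 * x)%:~R + y%:~R * sqrtC m%:~R ->
  a3 ^+ 2 + 4%:R * a6 = - 67%:R * v ^+ 3 ->
  P 37%:R -> ~ P q%:~R -> ~ P y%:~R ->
  good_reduction_at (quadK m) P (curve37 v a3 a6).
Proof.
move=> HP /intrP[n ->] {a3} mE q0 vE E P37 Pq Py.
have Ln := localRing_nat _ _ _ HP.
have qC : (q%:~R : algC) != 0 by rewrite intr_eq0.
set s := sqrtC m%:~R in vE *.
have sE : s ^+ 2 = 37%:R * q%:~R by rewrite sqrtCK mE intrM.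
have s0 : s != 0.
  apply/eqP => s0; move/eqP: sE.
  by rewrite s0 expr0n eq_sym mulf_eq0 (negPf qC) pnatr_eq0.
have Os : ringOfIntegers (quadK m) s := integer_sqrt m.
have nP n' : coprime n' 37 -> ~ P n'%:R.
  by move=> c Pn; apply: (prime_ideal_coprime m P n' 37 HP).
have Ps : P s.
  apply: (prime_ideal_exp m P s 2 HP Os); rewrite sE mulrC.
  by case: HP => _ [_ [_ [PM _]]]; apply: PM => //; apply: integer_int.
pose k := q%:~R * y%:~R + x%:~R * s.
have Ok : ringOfIntegers (quadK m) k.
  by apply: integerD; apply: integerM => //; apply: integer_int.
(* Modulo s, which lies in P, k is congruent to q y. *)
have Pk : ~ P k.
  have [_ [_ [PD [PM [_ [Pp _]]]]]] := HP => Pk.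
  have : P (q%:~R * y%:~R).
    have -> : q%:~R * y%:~R = k + (- x%:~R) * s by rewrite /k; ring.
    by apply: PD => //; apply: PM => //; apply: integerN; apply: integer_int.
  by move/(Pp _ _ (integer_int _ _) (integer_int _ _)) => [].
have skE : s * k = q%:~R * (37%:R * x%:~R + y%:~R * s).
  transitivity (q%:~R * y%:~R * s + x%:~R * s ^+ 2); first by rewrite /k; ring.
  by rewrite sE; ring.
have vk : v = s * k / (2%:R * q%:~R).
  have -> : v = (2%:R * v) / 2%:R by field.
  by rewrite vE skE intrM; field.
have a6E : a6 = (- 67%:R * v ^+ 3 - n%:~R ^+ 2) / 4%:R by rewrite -E; field.
have Ks := ringOfIntegers_quadK _ _ Os.
have Kv : quadK m v.
  rewrite vk; apply: quadKM; first by apply: quadKM => //; case: Ok.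
  by apply/quadKV/quadKM; [apply: (quadK_int m 2) | apply: quadK_int].
(* Translating x by -v/3 removes a2, and translating y by -n/2 removes a3. *)
exists s, (- (v / 3%:R)), 0, (- (n%:~R / 2%:R)); split.
  split=> //; try (exact: quadK0).
    by apply/quadKN/quadKM => //; apply: (quadKV m _ (quadK_int m 3)).
  by apply/quadKN/quadKM; [apply: quadK_int | apply: (quadKV m _ (quadK_int m 2))].
cbv zeta; rewrite wdisc_wchange // wdisc_curve37 //.
(* Once s^2 = 37 q is substituted, the powers of 37 cancel and the denominators 12 q^3, 864 q^5 are
   units at P. *)
have -> : wchange (curve37 v n%:~R a6) s (- (v / 3%:R)) 0 (- (n%:~R / 2%:R))
   = WModel 0 0 0 (- (k ^+ 2 * (12%:R * q%:~R ^+ 3)^-1))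
       (- (s * k ^+ 3 * (864%:R * q%:~R ^+ 5)^-1)).
  transitivity (WModel 0 0 0 (- (37%:R * k ^+ 2 / (12%:R * q%:~R ^+ 2 * s ^+ 2)))
       (- (37%:R ^+ 2 * s * k ^+ 3 / (864%:R * q%:~R ^+ 3 * (s ^+ 2) ^+ 2)))).
    rewrite a6E vk /wchange /curve37 /=; congr WModel; field; rewrite ?s0 ?qC //.
  by rewrite sE; congr WModel; field; rewrite qC.
have -> : 37%:R ^+ 3 * v ^+ 6 / s ^+ 12 = k ^+ 6 * (64%:R * q%:~R ^+ 9)^-1.
  transitivity (37%:R ^+ 3 * k ^+ 6 / (64%:R * q%:~R ^+ 6 * (s ^+ 2) ^+ 3)).
    by rewrite vk; field; rewrite s0 qC.
  by rewrite sE; field; rewrite qC.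
have Uk := localUnit_integer _ _ _ HP Ok Pk.
have Uq := localUnit_integer _ _ _ HP (integer_int m q) Pq.
have Un n' e : coprime n' 37 -> localUnit (quadK m) P (n'%:R * q%:~R ^+ e)^-1.
  move=> c; apply/localUnitV/(localUnitM _ _ _ _ HP); last exact: localUnitX.
  exact: localUnit_integer HP (integer_nat _ _) (nP _ c).
split; last by apply: localUnitM _ _ _ _ HP (localUnitX _ _ _ _ HP Uk) (Un 64 9 _).
have Lk e := integer_localRing _ _ _ HP (integerX _ _ e Ok).
split; try exact: (Ln 0); rewrite /=.
  apply: localRingN (localRingM _ _ _ _ HP (Lk 2) _).
  exact: localUnit_localRing (Un 12 3 isT).
apply/localRingN/localRingM => //; last first.
  exact: localUnit_localRing (Un 864 5 isT).
exact: integer_localRing HP (integerM _ _ _ Os (integerX _ _ 3 Ok)).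
Qed.

Lemma prime_ideal_int (m p n : int) (P : algC -> Prop) :
  nonzero_prime_ideal (quadK m) P -> prime `|p| -> P p%:~R -> P n%:~R ->
  (p %| n)%Z.
Proof.
move=> HP pp Pp Pn; apply/negPn/negP => pn.
apply: (prime_ideal_coprime m P p n HP) => //.
by rewrite coprimezE prime_coprime.
Qed.

(** If P contained v and its conjugate w, their product, sum and difference would put z, x and sqrt
    m in P; then P lies above some q_j dividing both x and z. And 2 is not in P because the odd
    number z is. *)
Lemma conj_not_in_prime_ideal (m q x y z : int) (P : algC -> Prop)
    (v w : algC) (qs : seq nat) :
  nonzero_prime_ideal (quadK m) P ->
  v * w = 37%:R * z%:~R ^+ 2 -> v + w = 37%:R * x%:~R ->
  v - w = y%:~R * sqrtC m%:~R ->
  m = 37 * q -> q = - (\prod_(p <- qs) p)%:Z -> coprimez 2 z -> (y %| 4)%Z ->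
  all prime qs ->
  (forall p, p \in qs -> (p%:Z %| x)%Z -> (p%:Z %| z)%Z -> False) ->
  ringOfIntegers (quadK m) v -> ringOfIntegers (quadK m) w ->
  ~ P 37%:R -> P v -> ~ P w /\ ~ P 2%:R.
Proof.
move=> HP Evw Es Ed mE qE z2 y4 aq H Ov Ow P37 Pv.
have [_ [_ [PD [PM [P1 [Pp _]]]]]] := HP.
have Oi n := integer_int m n; have On n := integer_nat m n.
have Pz : P z%:~R.
  have : P (37%:R * z%:~R ^+ 2) by rewrite -Evw mulrC; apply: PM.
  case/(Pp _ _ (On _) (integerX _ _ _ (Oi _))) => //.
  exact: (prime_ideal_exp _ _ _ 2 HP (Oi _)).
have P2 : ~ P 2%:R by move=> P2; apply: (prime_ideal_coprime m P 2 z HP).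
split=> // Pw.
have Px : P x%:~R.
  have : P (37%:R * x%:~R) by rewrite -Es; apply: PD.
  by case/(Pp _ _ (On _) (Oi _)).
have Py : ~ P y%:~R.
  (* Since y divides 4, having y in P would put 2 in P. *)
  case/dvdzP: y4 => e eE Py; apply: P2; apply: (prime_ideal_exp m P _ 2 HP (On _)).
  have -> : 2%:R ^+ 2 = e%:~R * y%:~R :> algC by rewrite -intrM -eE; ring.
  exact: PM.
have Pm : P m%:~R.
  have : P (y%:~R * sqrtC m%:~R).
    by rewrite -Ed; apply: PD => //; rewrite -mulN1r; apply: PM => //; apply: (Oi (-1)).
  case/(Pp _ _ (Oi _) (integer_sqrt _)) => // Ps.
  by rewrite -(sqrtCK m%:~R) expr2; apply: PM => //; apply: integer_sqrt.
have : P (\prod_(p <- qs) p)%:R.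
  move: Pm; rewrite mE intrM => /(Pp _ _ (Oi _) (Oi _))[] // Pq.
  have -> : (\prod_(p <- qs) p)%:R = (-1) * q%:~R :> algC.
    by rewrite qE mulN1r rmorphN opprK.
  by apply: PM => //; apply: (Oi (-1)).
case/(prime_ideal_prod _ _ _ HP) => p pqs Ppp.
have pp := allP aq _ pqs.
by apply: (H p pqs); apply: (prime_ideal_int m _ _ P HP).
Qed.

(** Three cases cover every prime P: above 37, then v outside P, then v in P, where the conjugate w
    is a unit at P and P does not lie above 2. *)
Lemma everywhere_good_reduction_curve37 (m q x y z : int) (v w tau : algC)
    (qs : seq nat) :
  2%:R * v = (37 * x)%:~R + y%:~R * sqrtC m%:~R ->
  v + w = 37%:R * x%:~R -> 4 * z ^+ 2 = 37 * x ^+ 2 - q * y ^+ 2 ->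
  ringOfIntegers (quadK m) tau -> v ^+ 3 = 1 + 4%:R * tau ->
  m = 37 * q -> q = - (\prod_(p <- qs) p)%:Z -> coprimez 2 z -> (y %| 4)%Z ->
  coprimez 37 q -> all prime qs ->
  (forall p, p \in qs -> (p%:Z %| x)%Z -> (p%:Z %| z)%Z -> False) ->
  [/\ elliptic_over (quadK m) (curve37 v 1 (- (17%:R + 67%:R * tau))),
    everywhere_good_reduction (quadK m) (curve37 v 1 (- (17%:R + 67%:R * tau)))
    & jinv (curve37 v 1 (- (17%:R + 67%:R * tau))) = (16 ^+ 3)%:R].
Proof.
move=> vE Es zE Otau v3 mE qE z2 y4 q37 aq H.
have Oi n := integer_int m n; have On n := integer_nat m n.
set s := sqrtC m%:~R in vE *.
have sE : s ^+ 2 = 37%:R * q%:~R by rewrite sqrtCK mE intrM.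
have zEC : 4%:R * z%:~R ^+ 2 = 37%:R * x%:~R ^+ 2 - q%:~R * y%:~R ^+ 2 :> algC.
  have := congr1 (fun n : int => n%:~R : algC) zE.
  by rewrite !expr2 rmorphB !rmorphM.
have vE' : v = ((37 * x)%:~R + y%:~R * s) / 2%:R by rewrite -vE; field.
have wE : w = ((37 * x)%:~R - y%:~R * s) / 2%:R.
  by rewrite -[w](addKr v) Es vE' intrM; field.
(* The conic says exactly that v has norm 37 z^2. *)
have Evw : v * w = 37%:R * z%:~R ^+ 2.
  transitivity (((37 * x)%:~R ^+ 2 - y%:~R ^+ 2 * s ^+ 2) / 4%:R).
    by rewrite vE' wE; field.
  by rewrite sE -[z%:~R ^+ 2](@mulKf _ 4%:R) ?pnatr_eq0 // zEC intrM; field.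
have Ed : v - w = y%:~R * s by rewrite vE' wE; field.
have z0 : z != 0 by apply/eqP => z0; move: z2; rewrite z0.
have zC : (z%:~R : algC) != 0 by rewrite intr_eq0.
have v0 : v != 0.
  apply/eqP => v0; move: Evw; rewrite v0 mul0r => /esym/eqP.
  by rewrite mulf_eq0 pnatr_eq0 /= sqrf_eq0 (negPf zC).
have Kv : quadK m v.
  rewrite vE'; apply/quadKM/(quadKV m _ (quadK_int m 2)).
  apply/quadKD; first exact: quadK_int.
  by apply/quadKM/quadK_sqrt; apply: quadK_int.
have Ov : ringOfIntegers (quadK m) v.
  apply: (integer_quadratic m (37 * x) (37 * z ^+ 2) v Kv).
  have -> : (37 * z ^+ 2)%:~R = v * w by rewrite Evw !expr2 !intrM.
  by rewrite intrM -Es; ring.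
have Ow : ringOfIntegers (quadK m) w.
  have -> : w = (37 * x)%:~R - v by rewrite intrM -Es; ring.
  by apply: integerD => //; apply: integerN.
have a6E : 1 ^+ 2 + 4%:R * (- (17%:R + 67%:R * tau)) = - 67%:R * v ^+ 3.
  by rewrite v3; ring.
split; last exact: jinv_curve37.
  split; last by rewrite wdisc_curve37 // mulf_neq0 ?expf_neq0 ?pnatr_eq0.
  split; rewrite /=; try exact: quadK0; try exact: (quadK_int m 1); try done.
    by apply/quadKM/quadKX => //; apply/quadKN/(quadK_int m 12).
  apply/quadKN/quadKD; first exact: (quadK_int m 17).
  by apply: quadKM; [apply: (quadK_int m 67) | case: Otau].
move=> P HP; have [P37|P37] := classic (P 37%:R).
  have cop n : coprimez 37 n -> ~ P n%:~R.
    by move=> c; apply: (prime_ideal_coprime m P 37 n HP).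
  apply: (good_reduction_curve37_above_37 m q x y P v _ _ HP) => //; try exact: cop.
    by apply/eqP => q0; move: q37; rewrite q0.
  by apply: cop; rewrite coprimezE; apply: coprime_dvdr y4 _.
have [Pv|Pv] := classic (P v); last exact: good_reduction_curve37_unit.
have [Pw P2] := conj_not_in_prime_ideal _ _ _ _ _ _ _ _ _ HP Evw Es Ed mE qE
  z2 y4 aq H Ov Ow P37 Pv.
exact: (good_reduction_curve37_conj m z P v w).
Qed.

(** * The conic 4 z^2 = 37 x^2 - q y^2 *)

Lemma prime_sqr_ndvd_prod (s : seq nat) (p : nat) :
  all prime s -> uniq s -> p \in s -> ~~ (p ^ 2 %| \prod_(r <- s) r)%N.
Proof.
move=> ps us sp; have pp := allP ps p sp.
rewrite (perm_big _ (perm_to_rem sp)) big_cons expnS expn1 dvdn_pmul2l ?prime_gt0 //.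
rewrite Euclid_dvd_prod // big_has; apply/hasPn => r rs.
have /(allP ps) pr := mem_rem rs.
rewrite dvdn_prime2 //; apply: contraTneq rs => <-.
by rewrite mem_rem_uniqF.
Qed.

Lemma legendre37_sqr (p : nat) : legendre p%:Z 37 = 1 ->
  exists2 c : 'F_37, c != 0 & p%:R = c ^+ 2.
Proof.
rewrite /legendre; case: ifP => // p37; case: ifP => // /existsP[x].
rewrite eqz_mod_dvd subr0 (dvdz_pcharf (pchar_Fp (isT : prime 37))).
rewrite rmorphB rmorphXn /= subr_eq0 -!pmulrn => /eqP xE _.
exists (x : nat)%:R => //; apply/eqP => x0.
move: p37; rewrite (dvdz_pcharf (pchar_Fp (isT : prime 37))).
by rewrite -pmulrn -xE x0 expr0n eqxx.
Qed.

Lemma legendre37_sqrt_mod (p : nat) : prime p -> legendre p%:Z 37 = 1 ->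
  exists k : nat, (p%:Z %| k%:Z ^+ 2 - 37)%Z.
Proof.
move=> pp /legendre37_sqr[c c0 cE].
(* 6^2 = 36 = -1 in the field with 37 elements. *)
apply: (sqrt_mod_of_reciprocity p 37 (6%:R : 'F_37) c) => //.
exact/eqP.
Qed.

(** Naming n mod 4 and the resulting n^2 mod 8 together leaves only linear arithmetic for the case
    analysis. *)
Lemma sqr_mod8 (n : int) : exists k e i : int,
  [/\ n = 4 * k + i, n ^+ 2 = 8 * e + i ^+ 2 & 0 <= i < 4].
Proof.
have n4 := divz_eq n 4; exists (n %/ 4)%Z.
move: (n %/ 4)%Z (n %% 4)%Z (@modz_ge0 n 4 isT) (@ltz_mod n 4 isT) n4 => k i i0 i4 ->.
exists (2 * k ^+ 2 + k * i), i; split; [ring | ring | lia].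
Qed.

(** For odd b, use 4 Q = (2 a + b)^2 - 37 b^2; for b = 2 c, use Q = (a + c)^2 - 37 c^2. The sign of
    x0 is chosen so that 37 x0 = -1 mod 4, which later makes v^3 = 1 mod 4. *)
Lemma conic_point (Q a b : int) : Q = norm37 a b -> (Q = 7 %[mod 8])%Z ->
  exists x0 z, [/\ (x0 = 3 %[mod 4])%Z, coprimez 2 z &
    z ^+ 2 = 37 * x0 ^+ 2 + 4 * Q \/ 4 * z ^+ 2 = 37 * x0 ^+ 2 + Q].
Proof.
rewrite /norm37 => QE Q8.
have co2 k : coprimez 2 (2 * k + 1).
  by apply/coprimezP; exists (- k, 1) => /=; ring.
have adjust (x : int) : (x = 1 %[mod 4])%Z \/ (x = 3 %[mod 4])%Z ->
    exists2 x0, (x0 = 3 %[mod 4])%Z & x0 ^+ 2 = x ^+ 2.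
  by case=> x4; [exists (- x); [lia | ring] | exists x].
have [b4|[c bE]] : ((b = 1 %[mod 4])%Z \/ (b = 3 %[mod 4])%Z) \/
    exists c, b = 2 * c.
- have [d dE] : exists d, b = 2 * d \/ b = 2 * d + 1.
    by exists (b %/ 2)%Z; have := divz_eq b 2; lia.
  by case: dE => dE; [right; exists d | left; lia].
- have [x0 x04 x0E] := adjust b b4; exists x0, (2 * a + b); split=> //.
    have [d ->] : exists d, b = 2 * d + 1.
      by exists (b %/ 2)%Z; have := divz_eq b 2; lia.
    by rewrite addrA -mulrDr.
  by left; rewrite x0E QE; ring.
have QE' : Q = (a + c) ^+ 2 - 37 * c ^+ 2 by rewrite QE bE; ring.
have [k [e [i [wE w2 i4]]]] := sqr_mod8 (a + c).
have [l [f [j [cE c2 j4]]]] := sqr_mod8 c.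
(* Modulo 8 the equation reads 7 = (a + c)^2 - 5 c^2; it forces c odd and a + c = 2 mod 4, so (a +
   c) / 2 is odd. *)
have [i2 j13] : i = 2 /\ (j = 1 \/ j = 3).
  have : i = 0 \/ i = 1 \/ i = 2 \/ i = 3 by lia.
  have : j = 0 \/ j = 1 \/ j = 2 \/ j = 3 by lia.
  move: Q8; rewrite QE' w2 c2 => Q8 ij.
  by case: ij Q8 => [->|[->|[->|->]]] Q8; case=> [iE|[iE|[iE|iE]]];
    move: Q8; rewrite iE; lia.
have [|x0 x04 x0E] := adjust c; first by lia.
exists x0, (2 * k + 1); split=> //; right; rewrite x0E QE' wE i2; ring.
Qed.

(** * From a point of the conic to the curve *)

Theorem theorem1p4 (qs : seq nat) (q m : int) :
  all prime qs -> uniq qs ->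
  (forall qj, qj \in qs -> legendre qj%:Z 37 = 1) ->
  q = - (\prod_(qj <- qs) qj)%:Z ->
  (q = 1 %[mod 8])%Z ->
  m = 37 * q ->
  exists E : wmodel,
    [/\ elliptic_over (quadK m) E,
        everywhere_good_reduction (quadK m) E
      & jinv E = (16 ^+ 3)%:R].
Proof.
move=> aq uq leg qE q8 mE; set Q := (\prod_(qj <- qs) qj)%N in qE.
have Q8 : (Q%:Z = 7 %[mod 8])%Z by move: q8; rewrite qE; lia.
have dQ p : p \in qs -> (p %| Q)%N.
  by move=> pq; rewrite /Q (perm_big _ (perm_to_rem pq)) big_cons dvdn_mulr.
have oddQ : odd Q by lia.
have oddq p : p \in qs -> odd p by move=> /dQ pQ; apply: dvdn_odd oddQ.
have q37 : coprimez 37 q.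
  rewrite qE coprimezN coprimezE prime_coprime //= /Q Euclid_dvd_prod //.
  rewrite big_has; apply/hasPn => p pq /=.
  by have := leg p pq; rewrite /legendre; case: ifP => // /negbT.
have [|a [b Qab]] := prod_norm37 qs.
  move=> p pq; have [k pk] := legendre37_sqrt_mod p (allP aq p pq) (leg p pq).
  exact: prime_norm37 (oddq p pq) pk.
have [x0 [z [x03 z2 xz]]] := conic_point _ _ _ Qab Q8.
(* A common factor p of x and z would give p^2 | Q y^2, hence p^2 | Q as p is odd and y divides 4;
   but Q is squarefree. *)
have sqfree x y : (y %| 4)%Z -> 4 * z ^+ 2 = 37 * x ^+ 2 - q * y ^+ 2 ->
    forall p, p \in qs -> (p%:Z %| x)%Z -> (p%:Z %| z)%Z -> False.
  move=> y4 E p pq /dvdzP[x' xE] /dvdzP[z' zE].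
  have /negP := prime_sqr_ndvd_prod qs p aq uq pq; apply; rewrite -/Q.
  have : (p%:Z ^+ 2 %| Q%:Z * y ^+ 2)%Z.
    apply/dvdzP; exists (4 * z' ^+ 2 - 37 * x' ^+ 2).
    transitivity (4 * z ^+ 2 - 37 * x ^+ 2); last by rewrite xE zE; ring.
    by rewrite E qE; ring.
  rewrite Gauss_dvdzl.
    by rewrite dvdzE abszX.
  rewrite coprimezE !abszX coprimeXl // coprimeXr //.
  by apply: coprime_dvdr y4 _; rewrite -[absz 4]/(2 ^ 2)%N coprimeXr // coprimen2 oddq.
set s : algC := sqrtC m%:~R.
have sE : s ^+ 2 = 37%:R * q%:~R by rewrite sqrtCK mE intrM.
have [r x0E] : exists r, x0 = 4 * r + 3.
  by exists (x0 %/ 4)%Z; have := divz_eq x0 4; lia.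
have [h qh] : exists h, q = 8 * h + 1.
  by exists (q %/ 8)%Z; have := divz_eq q 8; lia.
(* Integral because m = 1 mod 4: its trace is 1 and its norm (1 - m) / 4 = -74 h - 9. *)
pose om : algC := (1 + s) / 2%:R.
have Oom : ringOfIntegers (quadK m) om.
  apply: (integer_quadratic m 1 (- 74 * h - 9)).
    apply: quadKM; first by apply: quadKD (quadK_int m 1) (quadK_sqrt m).
    exact: (quadKV m _ (quadK_int m 2)).
  transitivity ((s ^+ 2 - 1) / 4%:R + (- 74 * h - 9)%:~R).
    by rewrite /om; field.
  by rewrite sE qh; field.
have Oi n := integer_int m n; have On n := integer_nat m n.
rewrite (_ : Posz _ = - q) in xz; last by rewrite qE opprK.
case: xz => xz.
  pose v : algC := 37%:R * x0%:~R + 2%:R * s.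
  pose w : algC := 37%:R * x0%:~R - 2%:R * s.
  pose tau0 : algC := 37%:R * r%:~R + 27%:R + om.
  (* Read off from the expansion of (1 + 4 tau0)^3. *)
  pose tau := 3%:R * tau0 + 12%:R * tau0 ^+ 2 + 16%:R * tau0 ^+ 3.
  have vE : v = 1 + 4%:R * tau0.
    by rewrite /v /tau0 /om x0E rmorphD rmorphM /=; field.
  exists (curve37 v 1 (- (17%:R + 67%:R * tau))).
  (* Multiplying the equation by 4 gives the point x = 2 x0, y = 4 of the conic. *)
  have E : 4 * z ^+ 2 = 37 * (2 * x0) ^+ 2 - q * 4 ^+ 2 by rewrite xz; ring.
  apply: (everywhere_good_reduction_curve37 m q (2 * x0) 4 z v w _ qs) => //.
  - by rewrite -/s /v !intrM; ring.
  - by rewrite /v /w !intrM; ring.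
  - by do !(exact: On || exact: Oi || exact: Oom || apply: integerX ||
      apply: integerD || apply: integerM).
  - by rewrite vE /tau; ring.
  - exact: sqfree E.
pose v : algC := (37%:R * x0%:~R + s) / 2%:R.
pose w : algC := (37%:R * x0%:~R - s) / 2%:R.
have E : 4 * z ^+ 2 = 37 * x0 ^+ 2 - q * 1 ^+ 2 by rewrite xz; ring.
have [k zE] : exists k, z = 2 * k + 1.
  have : odd `|z| by rewrite -coprime2n; apply: z2.
  by exists (z %/ 2)%Z; have := divz_eq z 2; lia.
have vE : v = om + 74%:R * r%:~R + 55%:R.
  by rewrite /v /om x0E rmorphD rmorphM /=; field.
have Ov : ringOfIntegers (quadK m) v.
  by rewrite vE; do !(exact: On || exact: Oi || exact: Oom || apply: integerD ||
    apply: integerM).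
have v2 : v ^+ 2 = 37%:R * x0%:~R * v - 37%:R * z%:~R ^+ 2.
  have qz : q%:~R = 37%:R * x0%:~R ^+ 2 - 4%:R * z%:~R ^+ 2 :> algC.
    have -> : q = 37 * x0 ^+ 2 - 4 * z ^+ 2 by rewrite E; ring.
    by rewrite !expr2 rmorphB !rmorphM.
  transitivity ((37%:R ^+ 2 * x0%:~R ^+ 2 + 2%:R * 37%:R * x0%:~R * s + s ^+ 2) / 4%:R).
    by rewrite /v; field.
  by rewrite sE qz /v; field.
(* v^3 = (t^2 - n) v - t n for the trace t = 37 x0 and the norm n = 37 z^2 of v,
   and t^2 - n = 4 A, - t n = 1 + 4 B. *)
pose A := 1369 * (4 * r ^+ 2 + 6 * r) - 37 * (k ^+ 2 + k) + 3071.
pose B := - 1369 * (r * (4 * k ^+ 2 + 4 * k + 1) + 3 * (k ^+ 2 + k)) - 1027.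
have v3 : v ^+ 3 = 1 + 4%:R * (A%:~R * v + B%:~R).
  transitivity (37%:R * x0%:~R * v ^+ 2 - 37%:R * z%:~R ^+ 2 * v).
    by rewrite exprS [in LHS]v2; ring.
  by rewrite v2 x0E zE /A /B; ring.
exists (curve37 v 1 (- (17%:R + 67%:R * (A%:~R * v + B%:~R)))).
apply: (everywhere_good_reduction_curve37 m q x0 1 z v w _ qs) => //.
- by rewrite -/s /v intrM; field.
- by rewrite /v /w; field.
- by apply: integerD => //; apply: integerM.
- exact: sqfree E.
Qed.
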